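(* Let $S_8=\{(1,-4,-3,4),(3,-3,-1,3)\}$. If $(t_1,t_2,t_3,t_4)\in S_8$, then for all integers $n\geq 0$, $$a_{1^{t_1}2^{t_2}3^{t_3}4^{t_4}}(2n)>0,\qquad a_{1^{t_1}2^{t_2}3^{t_3}4^{t_4}}(6n+1)<0,$$ $$a_{1^{t_1}2^{t_2}3^{t_3}4^{t_4}}(6n+3)<0,\qquad a_{1^{t_1}2^{t_2}3^{t_3}4^{t_4}}(6n+5)=0.$$
   Context: For $|q|<1$ (or as formal power series in $q$) let $f_j:=(q^j;q^j)_\infty=\prod_{k\ge 1}(1-q^{jk})$ for each positive integer $j$. For a positive integer $m$ and integers $t_1,\dots,t_m$ (possibly zero or negative), the integers $a_{1^{t_1}2^{t_2}\cdots m^{t_m}}(n)$, $n\ge 0$, are defined by $\sum_{n=0}^\infty a_{1^{t_1}2^{t_2}\cdots m^{t_m}}(n)q^n=f_1^{t_1}f_2^{t_2}\cdots f_m^{t_m}$. *)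

(* Defs.v *)
From HB Require Import structures.
From mathcomp Require Import all_boot all_order all_algebra.
From mathcomp Require Import boolp.

Set Implicit Arguments.
Unset Strict Implicit.
Unset Printing Implicit Defensive.

Import Order.TTheory GRing.Theory Num.Theory.
Local Open Scope ring_scope.

(******************************************************************************)
(* The ring Z[[q]] of formal power series in one variable q.                  *)
(*           fps == the type of formal power series with integer coefficients *)
(*           f n == the coefficient of q^n in f : fps (coercion to functions) *)
(*           fps is a comUnitRingType, the units being the series whose       *)
(*           constant coefficient is a unit of int; hence f ^ t makes sense   *)
(*           for t : int.                                                     *)
(*          fpsX == the variable q                                            *)
(*  fps_prod_inf == infinite product \prod_(k >= 1) F k                       *)
(*      eulerf j == (q^j; q^j)_oo = \prod_(k >= 1) (1 - q^(jk))               *)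
(* eta_coef t n  == the coefficient of q^n in f_1^{t_1} ... f_m^{t_m},        *)
(*                  where t = [:: t_1; ...; t_m] : seq int                    *)
(******************************************************************************)

Record fps := Fps { coef_fps :> nat -> int }.

Lemma fpsP (f g : fps) : (forall n, f n = g n) -> f = g.
Proof. by case: f g => [f] [g] /= /funext ->. Qed.

HB.instance Definition _ := gen_eqMixin fps.
HB.instance Definition _ := gen_choiceMixin fps.

Definition fps_zero := Fps (fun=> 0).
Definition fps_opp (f : fps) := Fps (fun n => - f n).
Definition fps_add (f g : fps) := Fps (fun n => f n + g n).

Fact fps_addA : associative fps_add.
Proof. by move=> f g h; apply: fpsP => n /=; rewrite addrA. Qed.
Fact fps_addC : commutative fps_add.
Proof. by move=> f g; apply: fpsP => n /=; rewrite addrC. Qed.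
Fact fps_add0 : left_id fps_zero fps_add.
Proof. by move=> f; apply: fpsP => n /=; rewrite add0r. Qed.
Fact fps_addN : left_inverse fps_zero fps_opp fps_add.
Proof. by move=> f; apply: fpsP => n /=; rewrite addNr. Qed.

HB.instance Definition _ :=
  GRing.isZmodule.Build fps fps_addA fps_addC fps_add0 fps_addN.

Definition fps_one := Fps (fun n => (n == 0%N)%:R).
Definition fps_mul (f g : fps) :=
  Fps (fun n => \sum_(i < n.+1) f i * g (n - i)%N).

Definition fps_trunc (N : nat) (f : fps) : {poly int} := \poly_(i < N) f i.

Lemma coef_fps_trunc N f n : (n < N)%N -> (fps_trunc N f)`_n = f n.
Proof. by move=> ltnN; rewrite coef_poly ltnN. Qed.

Lemma coef_trunc_mul N f g n :
  (n < N)%N -> (fps_trunc N f * fps_trunc N g)`_n = fps_mul f g n.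
Proof.
move=> ltnN; rewrite coefM; apply: eq_bigr => i _.
by rewrite !coef_fps_trunc // (leq_ltn_trans _ ltnN) ?leq_subr // -ltnS.
Qed.

Fact fps_mulC : commutative fps_mul.
Proof.
by move=> f g; apply: fpsP => n; rewrite -!(@coef_trunc_mul n.+1) // mulrC.
Qed.

Fact fps_mulA : associative fps_mul.
Proof.
move=> f g h; apply: fpsP => n.
set F := fps_trunc n.+1 f; set G := fps_trunc n.+1 g; set H := fps_trunc n.+1 h.
transitivity (F * (G * H))`_n.
  rewrite coefM /=; apply: eq_bigr => i _.
  by rewrite coef_fps_trunc // coef_trunc_mul // ltnS leq_subr.
rewrite mulrA coefM /=; apply: eq_bigr => i _.
by rewrite coef_trunc_mul // coef_fps_trunc // ltnS leq_subr.
Qed.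

Fact fps_mul1 : left_id fps_one fps_mul.
Proof.
move=> f; apply: fpsP => n /=; rewrite big_ord_recl /= mul1r subn0 big1 ?addr0 //.
by move=> i _; rewrite mul0r.
Qed.

Fact fps_mulDl : left_distributive fps_mul fps_add.
Proof.
move=> f g h; apply: fpsP => n /=; rewrite -big_split /=.
by apply: eq_bigr => i _; rewrite mulrDl.
Qed.

Fact fps_oner_neq0 : fps_one != 0 :> fps.
Proof. by apply/eqP => /(congr1 (fun f : fps => f 0%N)). Qed.

HB.instance Definition _ :=
  GRing.Zmodule_isComNzRing.Build fps
    fps_mulA fps_mulC fps_mul1 fps_mulDl fps_oner_neq0.

(* Keeps /= from unfolding ring operations under coef_fps.                    *)
Arguments coef_fps : simpl never.

Lemma coef_Fps F n : Fps F n = F n. Proof. by []. Qed.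
Lemma coef_fps0 n : (0 : fps) n = 0. Proof. by []. Qed.
Lemma coef_fps1 n : (1 : fps) n = (n == 0%N)%:R. Proof. by []. Qed.
Lemma coef_fpsD (f g : fps) n : (f + g) n = f n + g n. Proof. by []. Qed.
Lemma coef_fpsN (f : fps) n : (- f) n = - f n. Proof. by []. Qed.
Lemma coef_fpsB (f g : fps) n : (f - g) n = f n - g n. Proof. by []. Qed.
Lemma coef_fpsM (f g : fps) n :
  (f * g) n = \sum_(i < n.+1) f i * g (n - i)%N.
Proof. by []. Qed.

(* The first n.+1 coefficients of the inverse series, obtained by solving     *)
(* f * g = 1 degree by degree.                                                *)
Fixpoint fps_inv_seq (f : fps) (n : nat) : seq int :=
  if n is n'.+1 then
    let s := fps_inv_seq f n' in
    rcons s (- (f 0%N)^-1 * \sum_(i < n) f (n - i)%N * s`_i)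
  else [:: (f 0%N)^-1].

Definition fps_unit : {pred fps} := fun f => f 0%N \is a GRing.unit.
Definition fps_inv (f : fps) : fps :=
  if fps_unit f then Fps (fun n => (fps_inv_seq f n)`_n) else f.

Lemma size_fps_inv_seq f n : size (fps_inv_seq f n) = n.+1.
Proof. by elim: n => //= n IHn; rewrite size_rcons IHn. Qed.

Lemma nth_fps_inv_seq f n i :
  (i <= n)%N -> (fps_inv_seq f n)`_i = (fps_inv_seq f i)`_i.
Proof.
elim: n => [|n IHn]; first by rewrite leqn0 => /eqP->.
rewrite leq_eqVlt => /predU1P[-> //|]; rewrite ltnS => le_in.
by rewrite [in LHS]/= nth_rcons size_fps_inv_seq ltnS le_in IHn.
Qed.

Fact fps_mulVr : {in fps_unit, left_inverse 1 fps_inv *%R}.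
Proof.
move=> f Uf; have Uf0 : f 0%N \is a GRing.unit by [].
have {Uf}-> : fps_inv f = Fps (fun n => (fps_inv_seq f n)`_n).
  by rewrite /fps_inv ifT.
apply: fpsP => -[|n]; rewrite coef_fpsM coef_fps1.
  by rewrite big_ord1 coef_Fps /= mulVr.
rewrite big_ord_recr subnn coef_Fps /= nth_rcons size_fps_inv_seq ltnn eqxx.
rewrite mulrAC mulNr mulVr // mulN1r.
apply/eqP; rewrite subr_eq0; apply/eqP/eq_bigr => i _.
by rewrite coef_Fps mulrC [in RHS]nth_fps_inv_seq // -ltnS.
Qed.

Fact fps_unitPl (f g : fps) : g * f = 1 -> fps_unit f.
Proof.
move/(congr1 (fun h : fps => h 0%N)); rewrite coef_fpsM big_ord1 coef_fps1 /=.
by move=> gf1; apply/unitrPr; exists (g 0%N); rewrite mulrC.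
Qed.

Fact fps_inv_out : {in [predC fps_unit], fps_inv =1 id}.
Proof.
by move=> f Uf; rewrite /fps_inv ifN.
Qed.

HB.instance Definition _ :=
  GRing.ComNzRing_hasMulInverse.Build fps fps_mulVr fps_unitPl fps_inv_out.

Lemma fps_unitE (f : fps) : (f \is a GRing.unit) = (f 0%N \is a GRing.unit).
Proof. by []. Qed.

Definition fpsX : fps := Fps (fun n => (n == 1%N)%:R).

(* Meaningful when F k = 1 mod q^k for all k >= 1: the coefficient of q^n in  *)
(* the partial products then no longer changes from the n-th one on (see      *)
(* coef_eulerf for the case used here).                                       *)
Definition fps_prod_inf (F : nat -> fps) : fps :=
  Fps (fun n => (\prod_(1 <= k < n.+1) F k) n).

Definition eulerf (j : nat) : fps :=
  fps_prod_inf (fun k => 1 - fpsX ^+ (j * k)).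

Definition eta_coef (t : seq int) (n : nat) : int :=
  (\prod_(i < size t) eulerf i.+1 ^ t`_i) n.

Lemma coef_fpsXM f n : (fpsX * f) n = if n is n'.+1 then f n' else 0.
Proof.
rewrite coef_fpsM; case: n => [|n]; first by rewrite big_ord1 mul0r.
rewrite 2!big_ord_recl /= mul0r mul1r add0r subSS subn0 big1 ?addr0 // => i _.
by rewrite mul0r.
Qed.

Lemma coef_fpsXnM m f n :
  (fpsX ^+ m * f) n = if (n < m)%N then 0 else f (n - m)%N.
Proof.
elim: m n => [|m IHm] n; first by rewrite mul1r subn0.
by rewrite exprS -mulrA coef_fpsXM; case: n.
Qed.

Lemma coef_eulerf (j n N : nat) : (0 < j)%N -> (n <= N)%N ->
  (\prod_(1 <= k < N.+1) (1 - fpsX ^+ (j * k))) n = eulerf j n.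
Proof.
move=> j_gt0; elim: N => [|N IHN]; first by rewrite leqn0 => /eqP->.
rewrite leq_eqVlt => /predU1P[-> //|]; rewrite ltnS => le_nN.
have -> : \prod_(1 <= k < N.+2) (1 - fpsX ^+ (j * k)) =
    (1 - fpsX ^+ (j * N.+1)) * \prod_(1 <= k < N.+1) (1 - fpsX ^+ (j * k)).
  by rewrite big_nat_recr //; apply: mulrC.
rewrite mulrBl mul1r coef_fpsB IHN // coef_fpsXnM.
by rewrite (leq_ltn_trans le_nN) ?subr0 // leq_pmull.
Qed.

Lemma eulerf_unit (j : nat) : eulerf j \is a GRing.unit.
Proof. by rewrite fps_unitE coef_Fps big_geq. Qed.

(* Main.v *)
From HB Require Import structures.
Require Import Defs.
From mathcomp Require Import all_boot all_order all_algebra.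
From mathcomp Require Import boolp.
From mathcomp Require Import zify ring.
Import Order.TTheory GRing.Theory Num.Theory.
Local Open Scope ring_scope.

(* Write p = psi(q^2) = f_4^2/f_2 and r = psi(q^6) = f_12^2/f_6, where
   psi(q) = \sum_{n >= 0} q^(n(n+1)/2).  The two eta quotients are
     f_1 f_4^4 / (f_2^4 f_3^3) = (p^2 - q r^2) p r / f_6^6,
     f_1^3 f_4^3 / (f_2^3 f_3) = (p^2 - 3 q r^2) p / f_12,
   where only the factor q is odd, and the signs follow because p has
   nonnegative coefficients, supported on exponents 0 and 2 modulo 6.
   The first identity says that p^2 - q r^2 is an eta quotient; with the
   companion p^2 + q r^2 it is an instance of Weierstrass' three-term relation
   for theta functions, obtained from the Jacobi triple product and the
   duplication formula for a product of two theta functions.  The second one,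
   with the factor 3, follows algebraically from these two, from the modular
   equation phi(q) phi(q^3) - phi(-q) phi(-q^3) = 4 q psi(q^2) psi(q^6)
   and from Jacobi's phi(q)^4 - phi(-q)^4 = 16 q psi(q^2)^4 at q^3. *)

(** * Power series modulo [q ^ M] *)

Lemma coef_fps_sum (I : Type) (r : seq I) (P : pred I) (F : I -> fps) n :
  (\sum_(i <- r | P i) F i) n = \sum_(i <- r | P i) F i n.
Proof. exact: (big_morph (fun f : fps => f n) (fun _ _ => erefl) erefl). Qed.

Lemma coef_fpsXn m n : (fpsX ^+ m) n = (n == m)%:R.
Proof.
rewrite -[_ ^+ m]mulr1 coef_fpsXnM coef_fps1.
by case: ltngtP => [|ltmn|->]; rewrite ?subnn // subn_eq0 leqNgt ltmn.
Qed.

Lemma coef_fps_signM (b : bool) (f : fps) n :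
  ((-1) ^+ b * f) n = (-1) ^+ b * f n.
Proof. by case: b; rewrite ?mul1r // !mulN1r coef_fpsN. Qed.

(** The lowest nonzero coefficients of two nonzero series multiply to a coefficient of their
    product. Integrality gives cancellation and access to the fraction field through [tofrac]. *)
Lemma fps_integral (f g : fps) : f * g = 0 -> (f == 0) || (g == 0).
Proof.
have low (h : fps) : h != 0 -> exists2 m, h m != 0 & forall k, (k < m)%N -> h k = 0.
  move=> h0; have ex : exists n, h n != 0.
    apply/not_existsP => h_0; case/eqP: h0; apply: fpsP => n.
    by apply/eqP/negPn/negP/h_0.
  case: (ex_minnP ex) => m hm minm; exists m => // k ltkm.
  by apply/eqP/negPn/negP => /minm; rewrite leqNgt ltkm.
move=> fg0; apply/norP => -[/low[m fm ltm] /low[n gn ltn]].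
have /eqP := congr1 (fun h : fps => h (m + n)%N) fg0.
rewrite coef_fpsM (bigD1 (inord m)) //= inordK; last lia.
rewrite addKn big1 ?addr0 ?coef_fps0 ?mulf_eq0 ?(negPf fm) ?(negPf gn) // => i.
rewrite -val_eqE /= inordK; last by lia.
rewrite neq_ltn => /orP[/ltm ->|lt_mi]; first by rewrite mul0r.
by rewrite ltn ?mulr0 //; have := ltn_ord i; lia.
Qed.

HB.instance Definition _ := GRing.ComUnitRing_isIntegral.Build fps fps_integral.

Definition eqmodX M (f g : fps) := forall k, (k < M)%N -> f k = g k.

Lemma eqmodXM {M f f' g g'} :
  eqmodX M f f' -> eqmodX M g g' -> eqmodX M (f * g) (f' * g').
Proof.
move=> eqf eqg k ltk; rewrite !coef_fpsM; apply: eq_bigr => i _.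
by rewrite eqf ?eqg //; have := ltn_ord i; lia.
Qed.

Lemma eqmodX_prod (I : Type) (r : seq I) M (F G : I -> fps) :
  (forall i, eqmodX M (F i) (G i)) ->
  eqmodX M (\prod_(i <- r) F i) (\prod_(i <- r) G i).
Proof. by move=> FG; elim/big_rec2: _ => // i f g _; apply: eqmodXM. Qed.

Lemma eqmodXI M (f g h : fps) :
  h \is a GRing.unit -> eqmodX M (h * f) (h * g) -> eqmodX M f g.
Proof.
move=> Uh eqfg; rewrite -(mulKr Uh f) -(mulKr Uh g).
exact: eqmodXM.
Qed.

(** * Infinite products *)

(* [fps_prod_inf] with the factors numbered from 0. *)
Definition iprod (F : nat -> fps) := Fps (fun n => (\prod_(k < n) F k) n).

(** Factor [k] is 1 modulo q^(k+1), so it leaves the coefficients up to q^k unchanged; this is why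
    [iprod] may stop at [k < n] for the coefficient of q^n. *)
Definition iprodable (F : nat -> fps) := forall k, eqmodX k.+1 (F k) 1.

Lemma eqmodX_iprod F M N :
  iprodable F -> (M <= N)%N -> eqmodX M.+1 (iprod F) (\prod_(k < N) F k).
Proof.
move=> F1 leMN n; rewrite ltnS => /leq_trans/(_ leMN).
elim: N {leMN} => [|N IHN]; first by rewrite leqn0 => /eqP->.
rewrite leq_eqVlt => /predU1P[-> //|]; rewrite ltnS => lenN.
rewrite big_ord_recr /= IHN // -[in LHS](mulr1 (\prod_(k < N) F k)).
by apply: (@eqmodXM n.+1) => // k ltk; rewrite F1 //; lia.
Qed.

Lemma iprodM F G : iprodable F -> iprodable G ->
  iprod (fun k => F k * G k) = iprod F * iprod G.
Proof.
move=> F1 G1; apply: fpsP => n; rewrite {1}/iprod coef_Fps big_split.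
by apply: (@eqmodXM n.+1) => // k ltk; rewrite (@eqmodX_iprod _ n n).
Qed.

Lemma eq_iprod F G : F =1 G -> iprod F = iprod G.
Proof.
by move=> FG; apply: fpsP => n; rewrite /iprod !coef_Fps (eq_bigr (G \o val)).
Qed.

Lemma iprod1 : iprod (fun=> 1) = 1.
Proof. by apply: fpsP => n; rewrite {1}/iprod coef_Fps big1. Qed.

Lemma iprodable_sub F h : iprodable F -> (forall k, (k <= h k)%N) ->
  iprodable (F \o h).
Proof. by move=> F1 hk k i ltik; apply: F1; apply: leq_trans ltik _; rewrite ltnS. Qed.

(** The first [n * m] factors, regrouped by index modulo [m], determine all coefficients up to q^n
    on both sides. *)
Lemma iprod_residues F m : (0 < m)%N -> iprodable F ->
  iprod F = \prod_(i < m) iprod (fun k => F (i + m * k)%N).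
Proof.
move=> m0 F1; apply: fpsP => n.
have Fi1 (i : 'I_m) : iprodable (fun k => F (i + m * k)%N).
  by apply: (@iprodable_sub F (fun k => i + m * k)%N) => // k; nia.
rewrite (@eqmodX_iprod F n (n * m)) //; last by nia.
rewrite -(big_mkord xpredT) big_nat_mul big_mkord.
under eq_bigr => k _.
  rewrite -{1}[(k * m)%N]add0n big_addn mulSn addnK big_mkord; over.
rewrite exchange_big /=; apply: (@eqmodX_prod _ _ n.+1) => // i k ltk.
rewrite (@eqmodX_iprod _ n n) //; congr ((_ : fps) k).
by apply: eq_bigr => j _; rewrite mulnC.
Qed.

(* Beware of the sign: qpoch true a d = (q^a; q^d)_oo. *)
Definition qpoch (b : bool) (a d : nat) : fps :=
  iprod (fun k => 1 + (-1) ^+ b * fpsX ^+ (a + d * k)).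

Lemma iprodable_qpoch (b : bool) a d : (0 < a)%N -> (0 < d)%N ->
  iprodable (fun k => 1 + (-1) ^+ b * fpsX ^+ (a + d * k)).
Proof.
move=> a0 d0 k i ltik; rewrite coef_fpsD. rewrite coef_fps_signM coef_fpsXn.
by rewrite [i == _](_ : _ = false) ?mulr0 ?addr0 //; apply/eqP; nia.
Qed.

Lemma eulerfE j : eulerf j = qpoch true j j.
Proof.
apply: fpsP => n; rewrite /eulerf /qpoch /iprod !coef_Fps.
rewrite big_add1 big_mkord; congr ((_ : fps) n).
by apply: eq_bigr => k _; rewrite expr1 mulN1r mulnS.
Qed.

Lemma qpoch_residues b a d m : (0 < a)%N -> (0 < d)%N -> (0 < m)%N ->
  qpoch b a d = \prod_(i < m) qpoch b (a + d * i) (d * m).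
Proof.
move=> a0 d0 m0; rewrite /qpoch (@iprod_residues _ m) //.
  apply: eq_bigr => i _; apply: eq_iprod => k; congr (1 + _ * fpsX ^+ _); lia.
exact: iprodable_qpoch.
Qed.

Lemma qpoch_mulN a d : (0 < a)%N -> (0 < d)%N ->
  qpoch false a d * qpoch true a d = qpoch true (2 * a) (2 * d).
Proof.
move=> a0 d0; rewrite -iprodM; try exact: iprodable_qpoch.
apply: eq_iprod => k; rewrite -mulnA -mulnDr [(2 * _)%N]mulnC exprM; ring.
Qed.

(** * The finite triple product *)

Fixpoint qbin (R : comNzRingType) (Q : R) (n m : nat) {struct n} : R :=
  match n, m with
  | _, 0 => 1
  | 0, _.+1 => 0
  | n'.+1, m'.+1 => qbin R Q n' m' + Q ^+ m * qbin R Q n' m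
  end.
Arguments qbin {R} Q n m.

Lemma qbin0 (R : comNzRingType) (Q : R) n : qbin Q n 0 = 1.
Proof. by case: n. Qed.

Lemma qbin_small (R : comNzRingType) (Q : R) n m : (n < m)%N -> qbin Q n m = 0.
Proof.
elim: n m => [|n IHn] [|m] //= ltnm.
by rewrite !IHn ?mulr0 ?addr0 //; apply: ltnW.
Qed.

Lemma qbin_fact (R : comNzRingType) (Q : R) n m : (m <= n)%N ->
  qbin Q n m * \prod_(i < m) (1 - Q ^+ i.+1) * \prod_(i < n - m) (1 - Q ^+ i.+1)
  = \prod_(i < n) (1 - Q ^+ i.+1).
Proof.
elim: n m => [|n IHn] [|m] // lemn; try by rewrite qbin0 big_ord0 !mul1r ?subn0.
rewrite /= subSS [in RHS]big_ord_recr /=.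
have IHm := IHn m lemn.
move: lemn; rewrite ltnS leq_eqVlt => /predU1P[eqmn|ltmn].
  subst m; rewrite (@qbin_small _ _ n n.+1) // mulr0 addr0 big_ord_recr /=.
  by rewrite mulrA mulrAC IHm.
have IHm1 := IHn m.+1 ltmn.
rewrite -[(n - m)%N]prednK ?subn_gt0 // -subnS in IHm *.
(* The two summands match the two terms of the q-Pascal recurrence. *)
rewrite [in RHS](_ : 1 - Q ^+ n.+1 =
  (1 - Q ^+ m.+1) + Q ^+ m.+1 * (1 - Q ^+ (n - m.+1).+1)); last first.
  by rewrite mulrBr -exprD mulr1 addrA subrK; congr (1 - Q ^+ _); lia.
rewrite mulrDr -{1}IHm mulrCA -[in X in _ = _ + X]IHm1.
rewrite !big_ord_recr /= ; ring.
Qed.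

(** The q-binomial theorem in homogeneous form: setting [w] to a power of q later avoids negative
    exponents. The induction splits off the factor [w + y] and replaces [y] by [y * Q]. *)
Lemma qbin_thm (R : comNzRingType) (Q w y : R) n :
  \prod_(k < n) (w + y * Q ^+ k) =
  \sum_(m < n.+1) Q ^+ 'C(m, 2) * qbin Q n m * y ^+ m * w ^+ (n - m).
Proof.
elim: n y => [|n IHn] y; first by rewrite big_ord0 big_ord1 /= !mul1r.
rewrite big_ord_recl expr0 mulr1.
under eq_bigr => k _ do rewrite /= exprS mulrA.
rewrite IHn mulrDl !big_distrr /= big_ord_recl [RHS]big_ord_recl /= !qbin0.
have -> : \sum_(i < n.+1) y * (Q ^+ 'C(i, 2) * qbin Q n i * (y * Q) ^+ i * w ^+ (n - i)) =
  \sum_(i < n.+1) Q ^+ 'C(bump 0 i, 2) * qbin Q n i * y ^+ i.+1 * w ^+ (n - i).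
  apply: eq_bigr => i _; rewrite /bump /= add1n binS bin1 exprD exprMn exprS; ring.
rewrite -addrA; congr (_ + _).
  by rewrite !subn0 exprS !mulr1 !mul1r.
rewrite [in RHS]big_ord_recr /= [in X in _ + X = _]big_ord_recr /=.
rewrite (@qbin_small _ _ n (n.+1)) // mulr0 addr0 addrA -big_split /=.
congr (_ + _).
apply: eq_bigr => i _; rewrite /bump /= add1n subSS binS bin1 exprD exprMn.
rewrite (_ : n - i = (n - i.+1).+1)%N; last by have := ltn_ord i; lia.
rewrite !exprS; ring.
Qed.

Arguments qbin : simpl never.

(** * Series indexed by an arbitrary set *)

(* f = \sum_i c_i q^(e i), the sum having finitely many terms up to each
   degree. *)
Definition qseries (I : eqType) (e c : I -> int) (f : fps) :=
  forall N : nat, exists2 s : seq I,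
    uniq s /\ (forall i, e i <= N%:Z -> i \in s) &
    forall n, (n <= N)%N -> f n = \sum_(i <- s | e i == n%:Z) c i.

Lemma eq_big_uniq_support (I : eqType) (P : pred I) (c : I -> int) (s t : seq I) :
  uniq s -> uniq t -> (forall i, P i -> i \in s) -> (forall i, P i -> i \in t) ->
  \sum_(i <- s | P i) c i = \sum_(i <- t | P i) c i.
Proof.
move=> us ut Ps Pt; rewrite -big_filter -[RHS]big_filter.
apply/perm_big/uniq_perm; rewrite ?filter_uniq // => i; rewrite !mem_filter.
by apply/andP/andP => -[Pi _]; split; rewrite ?Ps ?Pt.
Qed.

(** The theta identities below rest on this uniqueness: both sides are exhibited as expansions of
    one indexed family. *)
Lemma qseries_inj (I : eqType) (e c : I -> int) (f g : fps) :
  qseries I e c f -> qseries I e c g -> f = g.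
Proof.
move=> hf hg; apply: fpsP => n.
have [s [us es] ->] // := hf n; have [t [ut et] ->] // := hg n.
by apply: eq_big_uniq_support => // i /eqP ei; [apply: es|apply: et]; rewrite ei.
Qed.

(** * Theta series with quadratic exponents *)

Definition int_window (N : nat) : seq int :=
  [seq k%:Z - N%:Z | k <- iota 0 (2 * N).+1].

Lemma int_window_uniq N : uniq (int_window N).
Proof. by rewrite map_inj_uniq ?iota_uniq // => i j; lia. Qed.

Lemma mem_int_window N (i : int) : (`|i|%N <= N)%N -> i \in int_window N.
Proof.
move=> leiN; apply/mapP; exists (absz (i + N%:Z)); last by lia.
by rewrite mem_iota; lia.
Qed.

Definition quad (h c : nat) (i : int) : int := h%:Z * i ^+ 2 + c%:Z * i.

Definition isign (b : bool) (i : int) : int := (-1) ^+ (b && odd `|i|%N).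

(* The window contains all the exponents up to n only if 0 < h and c <= h. *)
Definition theta (b : bool) (h c : nat) : fps :=
  Fps (fun n => \sum_(i <- int_window n.+1 | quad h c i == n%:Z) isign b i).

(** An exponent at most [N] thus forces [|i| <= N + 1], so windows of radius [N.+1] miss no term. *)
Lemma quad_ge h c i : (0 < h)%N -> (c <= h)%N -> `|i| - 1 <= quad h c i.
Proof.
move=> h0 lech; rewrite /quad; have [i0|i0] := lerP 0 i; first by nia.
rewrite -[i]opprK; set j := - i in i0 *; have j0: 0 < j by lia.
have: 0 <= h%:Z * j * (j - 1) by rewrite !mulr_ge0; lia.
nia.
Qed.

Lemma quad_ge0 h c i : (0 < h)%N -> (c <= h)%N -> 0 <= quad h c i.
Proof.
move=> h0 lech; have := quad_ge h c i h0 lech.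
have [->|i0] := eqVneq i 0; first by rewrite /quad; lia.
by move: i0 (quad h c i) => i0 x; lia.
Qed.

Lemma theta_qseries b h c : (0 < h)%N -> (c <= h)%N ->
  qseries int (quad h c) (isign b) (theta b h c).
Proof.
move=> h0 lech N; exists (int_window N.+1).
  split=> [|i lei]; first exact: int_window_uniq.
  by apply: mem_int_window; have := quad_ge h c i h0 lech; lia.
move=> n lenN; rewrite coef_Fps.
by apply: eq_big_uniq_support; rewrite ?int_window_uniq // => i /eqP ei;
  apply: mem_int_window; have := quad_ge h c i h0 lech; lia.
Qed.

Lemma sign_andb_odd (R : pzRingType) (b : bool) n :
  (-1) ^+ (b && odd n) = ((-1) ^+ b) ^+ n :> R.
Proof. by case: b; rewrite /= ?expr1n // expr1 signr_odd. Qed.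

Lemma fpsX_neq0 : fpsX != 0.
Proof. by apply/eqP => /(congr1 (fun f : fps => f 1%N)); rewrite coef_Fps. Qed.

Lemma fps_sign_sqr (b : bool) : (-1) ^+ b * (-1) ^+ b = 1 :> fps.
Proof. by rewrite -signr_addb addbb. Qed.

(** This is the q-binomial theorem with base q^(2h) and [2 * n] factors, its summation index
    recentred at [n], after multiplication by a signed power of q. *)
Lemma fin_triple_product (b : bool) h c n : (0 < h)%N -> (c < h)%N ->
  \prod_(k < n) (1 + (-1) ^+ b * fpsX ^+ (h + c + 2 * h * k)) *
  \prod_(k < n) (1 + (-1) ^+ b * fpsX ^+ (h - c + 2 * h * k)) =
  \sum_(m < (2 * n).+1) (-1) ^+ (b && odd `|m%:Z - n%:Z|) *
     fpsX ^+ `|quad h c (m%:Z - n%:Z)| * qbin (fpsX ^+ (2 * h)) (2 * n) m.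
Proof.
move=> h0 ltch.
(* The total power of q taken out of the [2 * n] factors: 2hn from each of the upper [n] factors and
   h + c + 2hk, for k < n, from the lower ones. *)
pose L := (3 * h * (n * n) + c * n)%N.
have XL0 : (-1) ^+ b ^+ n * fpsX ^+ L != 0 :> fps.
  by rewrite mulf_neq0 // !expf_neq0 ?oppr_eq0 ?oner_eq0 ?fpsX_neq0.
apply: (mulfI XL0).
transitivity (\prod_(k < 2 * n) (fpsX ^+ (2 * h * n) +
   (-1) ^+ b * fpsX ^+ (h + c) * (fpsX ^+ (2 * h)) ^+ k)).
  set F := fun k : nat => fpsX ^+ (2 * h * n) +
    (-1) ^+ b * fpsX ^+ (h + c) * (fpsX ^+ (2 * h)) ^+ k.
  (* The lower half, read backwards, yields the factors with [h - c], and the upper half those with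
     [h + c]. *)
  have -> : \prod_(k < 2 * n) F k = \prod_(k < n) F k * \prod_(k < n) F (k + n)%N.
    rewrite -!(big_mkord xpredT) mul2n -addnn (@big_cat_nat _ _ _ n) ?leq_addr //=.
    congr (_ * _); have := @big_addn _ 1 *%R 0 (n + n) n xpredT F.
    by rewrite add0n addnK big_mkord.
  rewrite [\prod_(k < n) F k] (reindex_inj rev_ord_inj) /= -big_split /= -big_split /=.
  have sumL m : (\sum_(k < m) (h + c + 2 * h * k) = h * (m * m) + c * m)%N.
    by elim: m => [|m IHm]; rewrite ?big_ord0 ?big_ord_recr /= ?IHm; lia.
  have -> : (-1) ^+ b ^+ n * fpsX ^+ L =
      \prod_(k < n) ((-1) ^+ b * fpsX ^+ (h + c + 2 * h * (n - k.+1) + 2 * h * n)).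
    rewrite big_split /= prodr_const card_ord; congr (_ * _).
    rewrite -expr_sum; congr (_ ^+ _).
    rewrite big_split /= sum_nat_const card_ord.
    rewrite (reindex_inj rev_ord_inj) /=.
    rewrite (eq_bigr (fun k : 'I_n => (h + c + 2 * h * k)%N)) ?sumL /L; first by nia.
    by move=> k _; rewrite subnSK ?subKn // ltnW.
  rewrite -big_split; apply: eq_bigr => k _ /=.
  have ltkn := ltn_ord k; rewrite /F.
  have e1 : fpsX ^+ (2 * h * n) =
      fpsX ^+ (h + c + 2 * h * (n - k.+1)) * fpsX ^+ (h - c + 2 * h * k).
    by rewrite -exprD; congr (_ ^+ _); nia.
  have e2 : (fpsX ^+ (2 * h)) ^+ (k + n) = fpsX ^+ (2 * h * k) * fpsX ^+ (2 * h * n).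
    by rewrite -exprM mulnDr exprD.
  rewrite e2 -[(fpsX ^+ (2 * h)) ^+ _]exprM !exprD e1 !exprD.
  have := fps_sign_sqr b; set s := (-1) ^+ b => ss.
  move: (fpsX ^+ (2 * h * (n - k.+1))) (fpsX ^+ (2 * h * k)) => u w.
  move: (fpsX ^+ h) (fpsX ^+ c) (fpsX ^+ (h - c)) => x y z.
  (* The two sides agree because the sign [s] squares to 1: their difference is a multiple of
     [s * s - 1]. *)
  apply/eqP; rewrite -subr_eq0; apply/eqP.
  transitivity ((x * y * u * (z * w)) ^+ 2 * (1 + s * (x * y * w)) * (s * s - 1)).
    by ring.
  by rewrite ss subrr mulr0.
rewrite qbin_thm big_distrr /=; apply: eq_bigr => m _.
have ltm := ltn_ord m.
rewrite exprMn -!exprM.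
have -> : (-1) ^+ (b && odd `|m%:Z - n%:Z|) =
    (-1) ^+ (b * m) * (-1) ^+ (b * n) :> fps.
  have -> : odd `|m%:Z - n%:Z| = odd (m + n).
    by lia.
  by rewrite sign_andb_odd -exprM mulnDr exprD.
have sn : (-1) ^+ (b * n) * (-1) ^+ (b * n) = 1 :> fps.
  by rewrite exprM -exprMn fps_sign_sqr expr1n.
(* Completing the square: h m (m - 1) + (h + c) m + 2 h n (2 n - m) = L + h (m - n)^2 + c (m -
   n). *)
have expE : fpsX ^+ (2 * h * 'C(m, 2)) * fpsX ^+ ((h + c) * m) *
    fpsX ^+ (2 * h * n * (2 * n - m)) = fpsX ^+ L * fpsX ^+ `|quad h c (m%:Z - n%:Z)|.
  rewrite -!exprD; congr (_ ^+ _).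
  have bE : (2 * 'C(m, 2))%:Z = m%:Z * m%:Z - m%:Z.
    by rewrite -mul_bin_diag bin1; case: (m : nat) => // k; lia.
  apply/eqP; rewrite -eqz_nat !PoszD gez0_abs; last by apply: quad_ge0 => //; lia.
  have -> : (2 * h * 'C(m, 2))%:Z = h%:Z * (m%:Z * m%:Z - m%:Z).
    by rewrite -bE -PoszM mulnCA mulnA.
  rewrite (PoszM (2 * h * n)) -subzn; last by lia.
  by rewrite /L /quad !PoszD !PoszM; apply/eqP; ring.
move: sn expE.
move: (fpsX ^+ _) (fpsX ^+ (_ * m)) (fpsX ^+ (_ * (_ - _))).
move: ((-1) ^+ (b * n)) => s x1 x2 x3 ss.
move: (fpsX ^+ L) (fpsX ^+ _) => x4 x5 expE.
set s' := (-1) ^+ _; set B := qbin _ _ _.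
transitivity (s' * (x1 * x2 * x3) * B); first by ring.
rewrite expE -[in LHS](mulr1 s') -ss; ring.
Qed.

(** * The Jacobi triple product as a limit of its finite form *)

Lemma eqmodX_eulerf d M n : (0 < d)%N -> (M <= n)%N ->
  eqmodX M.+1 (eulerf d) (\prod_(i < n) (1 - (fpsX ^+ d) ^+ i.+1)).
Proof.
move=> d0 leMn; rewrite eulerfE => k ltk.
rewrite (@eqmodX_iprod _ M n) //; last exact: iprodable_qpoch.
congr ((_ : fps) k); apply: eq_bigr => i _.
by rewrite expr1 mulN1r -exprM mulnS.
Qed.

(** Far from both ends of its row, the Gaussian binomial approaches the inverse of [eulerf d]: in
    [qbin_fact] all three products agree with [eulerf d] up to q^M. *)
Lemma eqmodX_qbin d n m M : (0 < d)%N -> (M <= m)%N -> (m + M <= n)%N ->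
  eqmodX M.+1 (qbin (fpsX ^+ d) n m * eulerf d) 1.
Proof.
move=> d0 leMm lemn; apply: (@eqmodXI _ _ _ _ (eulerf_unit d)) => k ltk.
rewrite mulr1 (@eqmodX_eulerf d M n) //; last by lia.
rewrite -(@qbin_fact _ _ n m); last by lia.
rewrite [eulerf d * _]mulrC.
apply: eqmodXM (ltk); last by apply: eqmodX_eulerf => //; lia.
by apply: eqmodXM => //; apply: eqmodX_eulerf.
Qed.

Lemma triple_product (b : bool) h c : (0 < h)%N -> (c < h)%N ->
  theta b h c =
  qpoch b (h + c) (2 * h) * qpoch b (h - c) (2 * h) * eulerf (2 * h).
Proof.
move=> h0 ltch; apply: (qseries_inj _ _ _ _ _ (theta_qseries b h c h0 (ltnW ltch))).
(* Terms of exponent at most [N] have index at most [M] in absolute value. After recentring at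
   [2 * M] they lie at distance at least [M] from both ends of the row [4 * M], as [eqmodX_qbin]
   requires. *)
move=> N; set M := N.+1; exists (int_window (2 * M)).
  split=> [|i lei]; first exact: int_window_uniq.
  by apply: mem_int_window; have := quad_ge h c i h0 (ltnW ltch); lia.
move=> k lekN.
have d0 : (0 < 2 * h)%N by lia.
transitivity ((\prod_(i < 2 * M) (1 + (-1) ^+ b * fpsX ^+ (h + c + 2 * h * i)) *
  \prod_(i < 2 * M) (1 + (-1) ^+ b * fpsX ^+ (h - c + 2 * h * i)) * eulerf (2 * h)) k).
  apply: (@eqmodXM M.+1); last by lia.
    apply: eqmodXM.
      by apply: eqmodX_iprod; [apply: iprodable_qpoch|]; lia.
    by apply: eqmodX_iprod; [apply: iprodable_qpoch|]; lia.
  by [].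
rewrite fin_triple_product // big_distrl /= coef_fps_sum /int_window big_map.
have -> : iota 0 (2 * (2 * M)).+1 = index_iota 0 (2 * (2 * M)).+1.
  by rewrite /index_iota subn0.
rewrite big_mkord.
rewrite [RHS]big_mkcond /=; apply: eq_bigr => m _.
have ltm := ltn_ord m.
rewrite -!mulrA coef_fps_signM coef_fpsXnM.
set i : int := m%:Z - (2 * M)%:Z.
have q0 := quad_ge0 h c i h0 (ltnW ltch).
have qge := quad_ge h c i h0 (ltnW ltch).
case: ifP => ltkE; first by rewrite mulr0 ifF //; lia.
rewrite (@eqmodX_qbin _ _ _ M) //; try (rewrite /i in qge q0 ltkE *; lia).
rewrite coef_fps1; have -> : (k - `|quad h c i| == 0)%N = (quad h c i == k%:Z) by lia.
by case: ifP; rewrite ?mulr1 ?mulr0.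
Qed.

(** * Products, shifts and splittings of indexed series *)

Lemma eq_qseries (I : eqType) (e e' c c' : I -> int) (f : fps) :
  e =1 e' -> c =1 c' -> qseries I e c f -> qseries I e' c' f.
Proof. by move=> /funext-> /funext->. Qed.

Lemma qseriesM (I J : eqType) (e c : I -> int) (e' c' : J -> int) (f g : fps) :
  (forall i, 0 <= e i) -> (forall j, 0 <= e' j) ->
  qseries I e c f -> qseries J e' c' g ->
  qseries (I * J)%type (fun p => e p.1 + e' p.2) (fun p => c p.1 * c' p.2) (f * g).
Proof.
move=> e0 e'0 hf hg N.
have [s [us es] fE] := hf N; have [t [ut et] gE] := hg N.
exists [seq (i, j) | i <- s, j <- t].
  split=> [|[i j] /= le]; first by rewrite allpairs_uniq // => -[? ?] [? ?].
  by rewrite allpairs_f ?es ?et //; have := e0 i; have := e'0 j; lia.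
move=> n lenN; rewrite coef_fpsM [RHS]big_mkcond big_allpairs /=.
transitivity (\sum_(k < n.+1) \sum_(i <- s) \sum_(j <- t)
   (if (e i == k%:Z) && (e' j == (n - k)%N%:Z) then c i * c' j else 0)).
  apply: eq_bigr => k _; have ltk := ltn_ord k.
  rewrite fE ?gE; try lia.
  rewrite big_mkcond big_distrl; apply: eq_bigr => i _ /=.
  rewrite [X in _ * X]big_mkcond big_distrr; apply: eq_bigr => j _ /=.
  by case: eqP; case: eqP; rewrite ?mulr0 ?mul0r.
rewrite exchange_big; apply: eq_bigr => i _ /=.
rewrite exchange_big; apply: eq_bigr => j _ /=.
have := e0 i; have := e'0 j; case: eqP => [eE|neE] e'j ei.
  rewrite (bigD1 (inord (absz (e i)))) //= inordK; last by lia.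
  rewrite ifT; last by lia.
  rewrite big1 ?addr0 // => k; rewrite -val_eqE /= inordK; last by lia.
  by move=> neq; rewrite ifF //; lia.
by rewrite big1 // => k _; have ltk := ltn_ord k; rewrite ifF //; lia.
Qed.

Lemma qseries_shift (I : eqType) (b : bool) (m : nat) (e c : I -> int) (f : fps) :
  (forall i, 0 <= e i) -> qseries I e c f ->
  qseries I (fun i => m%:Z + e i) (fun i => (-1) ^+ b * c i)
    ((-1) ^+ b * (fpsX ^+ m * f)).
Proof.
move=> e0 hf N; have [s [us es] fE] := hf N.
exists s; first by split=> // i le; apply: es; lia.
move=> n lenN; rewrite coef_fps_signM coef_fpsXnM -big_distrr; congr (_ * _).
case: ltnP => [ltnm|lemn].
  by rewrite big1 // => i /eqP ei; have := e0 i; lia.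
rewrite fE; last by lia.
by apply: eq_bigl => i; lia.
Qed.

(** The images of [h1] and [h2] partition the index set; parity substitutions in quadratic forms
    enter through this lemma. *)
Lemma qseries_split (I J : eqType) (h1 h2 : J -> I) (e c : I -> int) (f1 f2 : fps) :
  injective h1 -> injective h2 -> (forall j k, h1 j <> h2 k) ->
  (forall i, exists j, i = h1 j \/ i = h2 j) ->
  qseries J (e \o h1) (c \o h1) f1 -> qseries J (e \o h2) (c \o h2) f2 ->
  qseries I e c (f1 + f2).
Proof.
move=> inj1 inj2 dis cov q1 q2 N.
have [s1 [us1 es1] f1E] := q1 N; have [s2 [us2 es2] f2E] := q2 N.
exists (map h1 s1 ++ map h2 s2).
  split=> [|i le].
    rewrite cat_uniq !map_inj_uniq // us1 us2 andbT /=.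
    by apply/hasPn => _ /mapP[k _ ->]; apply/mapP => -[j _ /esym/dis].
  rewrite mem_cat; have [j [ij|ij]] := cov i.
    by rewrite ij map_f // es1 //= -ij.
  by rewrite ij [X in _ || X]map_f ?orbT // es2 //= -ij.
by move=> n lenN; rewrite coef_fpsD big_cat /= !big_map f1E // f2E.
Qed.

(** * Duplication formulas and the cubic modular equation *)

Lemma isign_false i : isign false i = 1. Proof. by []. Qed.

Lemma isignM b (i j : int) : isign b i * isign b j = (-1) ^+ (b && odd (absz (i + j))).
Proof.
have -> : odd (absz (i + j)) = odd `|i| (+) odd `|j| by lia.
by rewrite /isign; case: b => //=; rewrite signr_addb.
Qed.

Lemma theta_mul_qseries b h c h' c' : (0 < h)%N -> (c <= h)%N ->
  (0 < h')%N -> (c' <= h')%N ->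
  qseries (int * int)%type (fun p => quad h c p.1 + quad h' c' p.2)
    (fun p => (isign b p.1) * (isign b p.2)) (theta b h c * theta b h' c').
Proof.
move=> h0 lec h'0 lec'; apply: qseriesM; try exact: theta_qseries.
  by move=> i; apply: quad_ge0.
by move=> i; apply: quad_ge0.
Qed.

(* The substitutions are m = s + t, n = t - s for m + n even, and
   m = - s - t - 1, n = s - t for m + n odd. *)
Lemma theta_schroeter b h c d : (0 < h)%N -> (c <= h)%N -> (d <= c)%N ->
  theta b h c * theta b h d =
  theta false (2 * h) (c - d) * theta false (2 * h) (c + d) +
  (-1) ^+ b * (fpsX ^+ (h - c) * (theta false (2 * h) (2 * h - c + d) *
                                  theta false (2 * h) (2 * h - c - d))).
Proof.
move=> h0 lech ledc.
apply: (qseries_inj _ _ _ _ _ (theta_mul_qseries b h c h d _ _ _ _)) => //; try lia.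
pose h1 (p : int * int) := (p.1 + p.2, p.2 - p.1).
pose h2 (p : int * int) := (- p.1 - p.2 - 1, p.1 - p.2).
apply: (@qseries_split _ _ h1 h2).
- by move=> [s t] [s' t'] []; move=> *; congr pair; lia.
- by move=> [s t] [s' t'] []; move=> *; congr pair; lia.
- by move=> [s t] [s' t'] []; lia.
- move=> [m n]; have [ev|od] := eqVneq ((m + n) %% 2)%Z 0.
    exists (((m - n) %/ 2)%Z, ((m + n) %/ 2)%Z); left; rewrite /h1 /=; congr pair; lia.
  exists (((n - m) %/ 2)%Z, ((- m - n) %/ 2)%Z); right; rewrite /h2 /=; congr pair; lia.
- apply: eq_qseries (theta_mul_qseries false (2 * h) (c - d)
    (2 * h) (c + d) _ _ _ _); try lia.
    by move=> [s t]; rewrite /quad /= -subzn // !PoszD ?PoszM; ring.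
  move=> [s t] /=; rewrite !isign_false mulr1 isignM.
  by rewrite (_ : odd _ = false) ?andbF //; lia.
apply: eq_qseries (qseries_shift _ b (h - c) _ _ _ _
  (theta_mul_qseries false (2 * h) (2 * h - c + d)
     (2 * h) (2 * h - c - d) _ _ _ _)); try lia.
- move=> [s t]; rewrite /quad /= !PoszD -!subzn; lia.
- move=> [s t] /=; rewrite !isign_false !mulr1 isignM.
  by rewrite (_ : odd _ = true) ?andbT //; lia.
by move=> [s t]; rewrite addr_ge0 ?quad_ge0; lia.
Qed.

(** The exponent h m (m + 1) is invariant under m -> - m - 1, which exchanges even and odd indices,
    so each parity contributes the same series. *)
Lemma theta_double h : (0 < h)%N ->
  theta false h h = theta false (4 * h) (2 * h) + theta false (4 * h) (2 * h).
Proof.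
move=> h0; apply: (qseries_inj _ _ _ _ _ (theta_qseries false h h h0 (leqnn h))).
apply: (@qseries_split _ _ (fun m => 2 * m) (fun m => - 2 * m - 1)).
- by move=> m n /=; lia.
- by move=> m n /=; lia.
- by move=> m n /=; lia.
- move=> i; have [ev|od] := eqVneq (i %% 2)%Z 0.
    by exists (i %/ 2)%Z; left; lia.
  by exists ((- i) %/ 2)%Z; right; lia.
- apply: eq_qseries (theta_qseries false (4 * h) (2 * h) _ _) => //; try lia.
  by move=> m; rewrite /quad /= !PoszM; ring.
apply: eq_qseries (theta_qseries false (4 * h) (2 * h) _ _) => //; try lia.
by move=> m; rewrite /quad /= !PoszM; ring.
Qed.

(** Gives a series to a part of an index set without a closed form for it: the left inverse [g]
    carries finite windows back, and choice selects one for each bound. *)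
Lemma qseries_pullback (I J : eqType) (h : J -> I) (g : I -> J)
    (e c : I -> int) (c' : J -> int) (f : fps) :
  cancel h g -> qseries I e c f -> exists f', qseries J (e \o h) c' f'.
Proof.
move=> hK hf.
have cov N : exists s : seq J, uniq s /\ forall j, (e \o h) j <= N%:Z -> j \in s.
  have [s [us es] _] := hf N; exists (undup (map g s)); split.
    exact: undup_uniq.
  by move=> j le; rewrite mem_undup -[j]hK map_f // es.
have [S SP] := choice cov.
exists (Fps (fun n => \sum_(j <- S n | (e \o h) j == n%:Z) c' j)) => N.
exists (S N); first exact: SP.
move=> n lenN; rewrite coef_Fps; apply: eq_big_uniq_support => [||i /eqP ei|i /eqP ei].
- by case: (SP n).
- by case: (SP N).
- by case: (SP n) => _; apply; rewrite ei.
by case: (SP N) => _; apply; rewrite ei; lia.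
Qed.

(* With m + n odd, m^2 + 3 n^2 = (u^2 + 3 v^2) / 4 for u = m - 3 n and
   v = m + n; up to the sign of v, all pairs of odd u, v arise exactly once. *)
Lemma theta_cubic_modular :
  theta false 1 0 * theta false 3 0 - theta true 1 0 * theta true 3 0 =
  fpsX * (theta false 1 1 * theta false 3 3).
Proof.
pose e (p : int * int) := quad 1 0 p.1 + quad 3 0 p.2.
pose h1 (p : int * int) := (2 * p.1 + 3 * p.2, p.2).
pose h2 (p : int * int) := (2 * p.1 + 1 + 3 * p.2, p.2).
pose g (p : int * int) := (((p.1 - 3 * p.2) %/ 2)%Z, p.2).
have Tq b := theta_mul_qseries b 1 0 3 0 isT isT isT isT.
have h1K : cancel h1 g by move=> [k n]; rewrite /h1 /g /=; congr pair; lia.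
have h2K : cancel h2 g by move=> [k n]; rewrite /h2 /g /=; congr pair; lia.
(* [E] and [O] sum q^(m^2 + 3 n^2) over m + n even and odd. The sign for [b = true] is (-1)^(m + n),
   so the left side of the theorem is [O + O]. *)
have [E qE] := @qseries_pullback _ _ h1 g _ _ (fun=> 1) _ h1K (Tq false).
have [O qO] := @qseries_pullback _ _ h2 g _ _ (fun=> 1) _ h2K (Tq false).
have e0 (p : int * int) : 0 <= e p by rewrite addr_ge0 ?quad_ge0.
have TE (b : bool) : theta b 1 0 * theta b 3 0 = E + (-1) ^+ b * (fpsX ^+ 0 * O).
  apply: qseries_inj (Tq b) _; apply: (@qseries_split _ _ h1 h2).
  - exact: can_inj h1K.
  - exact: can_inj h2K.
  - by move=> [k n] [k' n'] []; lia.
  - move=> [m n]; exists (g (m, n)); have [ev|od] := eqVneq ((m + n) %% 2)%Z 0.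
      by left; rewrite /h1 /g /=; congr pair; lia.
    by right; rewrite /h2 /g /=; congr pair; lia.
  - apply: eq_qseries qE => // -[k n] /=; rewrite isignM.
    by rewrite (_ : odd _ = false) ?andbF //; lia.
  apply: eq_qseries (qseries_shift _ b 0 _ _ _ _ qO) => [[k n]|[k n]|[k n]] /=.
  - by rewrite add0r.
  - by rewrite isignM mulr1 (_ : odd _ = true) ?andbT //; lia.
  exact: e0 (h2 (k, n)).
(* [g1] and [g2] cover the pairs with even and odd sum and differ by the reflection l -> - 1 - l,
   which preserves 3 l^2 + 3 l; each half therefore contributes one copy of [O]. *)
pose g1 (p : int * int) := (p.1, p.1 + 2 * p.2).
pose g2 (p : int * int) := (p.1, - 1 - p.1 - 2 * p.2).
have XE : fpsX * (theta false 1 1 * theta false 3 3) = O + O.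
  have := qseries_shift _ false 1 _ _ _ _
    (theta_mul_qseries false 1 1 3 3 isT isT isT isT).
  rewrite mul1r expr1 => qX; apply: qseries_inj (qX _) _.
    by move=> p; rewrite addr_ge0 ?quad_ge0.
  apply: (@qseries_split _ _ g1 g2).
  - by move=> [k n] [k' n'] []; move=> *; congr pair; lia.
  - by move=> [k n] [k' n'] []; move=> *; congr pair; lia.
  - by move=> [k n] [k' n'] []; lia.
  - move=> [k l]; have [ev|od] := eqVneq ((k + l) %% 2)%Z 0.
      by exists (k, ((l - k) %/ 2)%Z); left; rewrite /g1 /=; congr pair; lia.
    by exists (k, ((- 1 - k - l) %/ 2)%Z); right; rewrite /g2 /=; congr pair; lia.
  - by apply: eq_qseries qO => -[k n] //=; rewrite /quad /=; ring.
  by apply: eq_qseries qO => -[k n] //=; rewrite /quad /=; ring.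
rewrite !TE XE; ring.
Qed.

(** * Theta functions as eta quotients *)

Lemma eulerf_odd_even k : (0 < k)%N ->
  eulerf k = qpoch true k (2 * k) * eulerf (2 * k).
Proof.
move=> k0; rewrite !eulerfE (@qpoch_residues _ _ _ 2) //.
rewrite !big_ord_recr big_ord0 /= mul1r muln0 addn0 muln1 addnn -mul2n.
by rewrite [(k * 2)%N]mulnC.
Qed.

Lemma qpochN_odd k : (0 < k)%N ->
  qpoch false k (2 * k) * eulerf k * eulerf (4 * k) = eulerf (2 * k) ^+ 2.
Proof.
move=> k0; rewrite (@eulerf_odd_even k) // mulrA qpoch_mulN ?muln_gt0 //.
rewrite [in RHS]expr2 [in X in _ = X * _]eulerf_odd_even ?muln_gt0 //.
by rewrite !mulnA /= mulrAC.
Qed.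

Lemma qpoch_halves (b : bool) k : (0 < k)%N ->
  qpoch b k (2 * k) = qpoch b k (4 * k) * qpoch b (3 * k) (4 * k).
Proof.
move=> k0; rewrite (@qpoch_residues _ _ _ 2) ?muln_gt0 //.
rewrite !big_ord_recr big_ord0 /= mul1r muln0 addn0 muln1.
by congr (qpoch _ _ _ * qpoch _ _ _); lia.
Qed.

(** In Ramanujan's notation [theta true k 0] is phi(-q^k), where phi(q) is the sum of q^(n^2) over
    all integers n; phi(q^k) and psi(q^k) follow. *)
Lemma theta_phiN k : (0 < k)%N ->
  theta true k 0 * eulerf (2 * k) = eulerf k ^+ 2.
Proof.
move=> k0; rewrite triple_product // addn0 subn0 [in RHS]eulerf_odd_even //; ring.
Qed.

Lemma theta_phi k : (0 < k)%N ->
  theta false k 0 * eulerf k ^+ 2 * eulerf (4 * k) ^+ 2 = eulerf (2 * k) ^+ 5.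
Proof.
move=> k0; rewrite triple_product // addn0 subn0.
transitivity ((qpoch false k (2 * k) * eulerf k * eulerf (4 * k)) ^+ 2 * eulerf (2 * k)).
  by ring.
by rewrite qpochN_odd //; ring.
Qed.

Lemma theta_psi k : (0 < k)%N ->
  theta false (2 * k) k * eulerf k = eulerf (2 * k) ^+ 2.
Proof.
move=> k0; rewrite triple_product; try lia.
rewrite -qpochN_odd // qpoch_halves // !mulnA.
rewrite (_ : 2 * k + k = 3 * k)%N; last by lia.
rewrite (_ : 2 * k - k = k)%N; last by lia.
ring.
Qed.

(** Euler's pentagonal number theorem at q^4. *)
Lemma theta_6_2 : theta true 6 2 = eulerf 4.
Proof.
rewrite triple_product // !eulerfE (@qpoch_residues _ 4 4 3) //.
rewrite !big_ord_recr big_ord0 /= mul1r.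
by rewrite [X in X * _]mulrC.
Qed.

Lemma theta_6_4 : theta true 6 4 * eulerf 4 * eulerf 6 = eulerf 2 * eulerf 12 ^+ 2.
Proof.
rewrite triple_product // !eulerfE (@qpoch_residues _ 4 4 3) //.
rewrite (@qpoch_residues _ 6 6 2) // (@qpoch_residues _ 2 2 6) //.
rewrite !big_ord_recr !big_ord0 /=.
move: (qpoch _ 2 12) (qpoch _ 4 12) (qpoch _ 6 12) => x2 x4 x6.
move: (qpoch _ 8 12) (qpoch _ 10 12) (qpoch _ 12 12) => x8 x10 x12; ring.
Qed.

Lemma theta_6_3 b : theta b 6 3 = qpoch b 3 6 * eulerf 12.
Proof.
by rewrite triple_product // (@qpoch_halves b 3) //= [_ * qpoch b 3 _]mulrC.
Qed.

(** The two triple products supply the residues 1, 5, 7, 11 modulo 12 and [qpoch b 3 6] supplies 3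
    and 9, together all the odd ones. *)
Lemma theta_6_5_1 b : theta b 6 5 * theta b 6 1 * qpoch b 3 6 =
  qpoch b 1 2 * eulerf 12 ^+ 2.
Proof.
rewrite !triple_product // (@qpoch_halves b 3) // (@qpoch_residues _ 1 2 6) //.
rewrite !big_ord_recr !big_ord0 /=.
move: (qpoch b 1 12) (qpoch b 3 12) (qpoch b 5 12) => x1 x3 x5.
move: (qpoch b 7 12) (qpoch b 9 12) (qpoch b 11 12) => x7 x9 x11.
move: (eulerf 12) => x12; ring.
Qed.

(* The duplication formula turns every product of two of these theta functions
   into a determinant, and the identity into a Plücker relation. *)
Lemma theta_weierstrass (b : bool) :
  theta b 6 5 * theta b 6 1 *
    (theta true 6 2 ^+ 2 - (-1) ^+ b * fpsX * theta true 6 4 ^+ 2) =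
  theta true 6 0 * theta true 6 4 * theta b 6 3 ^+ 2.
Proof.
have e1 : theta b 6 5 * theta b 6 1 = theta false 12 4 * theta false 12 6 +
    (-1) ^+ b * (fpsX ^+ 1 * (theta false 12 8 * theta false 12 6)).
  exact: theta_schroeter.
have e2 : theta true 6 2 * theta true 6 2 = theta false 12 0 * theta false 12 4 +
    (-1) ^+ true * (fpsX ^+ 4 * (theta false 12 12 * theta false 12 8)).
  exact: theta_schroeter.
have e3 : theta true 6 4 * theta true 6 4 = theta false 12 0 * theta false 12 8 +
    (-1) ^+ true * (fpsX ^+ 2 * (theta false 12 12 * theta false 12 4)).
  exact: theta_schroeter.
have e4 : theta true 6 4 * theta true 6 0 = theta false 12 4 * theta false 12 4 +
    (-1) ^+ true * (fpsX ^+ 2 * (theta false 12 8 * theta false 12 8)).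
  exact: theta_schroeter.
have e5 : theta b 6 3 * theta b 6 3 = theta false 12 0 * theta false 12 6 +
    (-1) ^+ b * (fpsX ^+ 3 * (theta false 12 12 * theta false 12 6)).
  exact: theta_schroeter.
rewrite !expr2 [theta true 6 0 * _]mulrC e1 e2 e3 e4 e5 {e1 e2 e3 e4 e5}.
move: (theta false 12 0) (theta false 12 4) (theta false 12 6) => t0 t4 t6.
move: (theta false 12 8) (theta false 12 12) fpsX => t8 t12 x.
by case: b; rewrite ?expr0 ?expr1; ring.
Qed.

(** * Algebra of eta quotients in a field *)

Section EtaAlgebra.

Variable F : fieldType.
Implicit Types x y z : F.

Let mulE {x y z : F} : x * y = z -> y != 0 -> x = z / y.
Proof. by move=> <- ny; rewrite mulfK. Qed.

Variables q f1 f2 f3 f4 f6 f12 : F.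
Hypotheses (nf1 : f1 != 0) (nf2 : f2 != 0) (nf3 : f3 != 0) (nf4 : f4 != 0).
Hypotheses (nf6 : f6 != 0) (nf12 : f12 != 0).

(** Here [j2] and [j6] stand for [theta true 6 4] and [theta true 6 0], [j] for the product of
    [theta b 6 5] and [theta b 6 1], and [u], [w] for [qpoch b 1 2] and [qpoch b 3 6]. *)
Lemma eta_weierstrass (s p r j2 j6 u w j : F) :
  p * f2 = f4 ^+ 2 -> r * f6 = f12 ^+ 2 ->
  j2 * f4 * f6 = f2 * f12 ^+ 2 -> j6 * f12 = f6 ^+ 2 ->
  u != 0 -> w != 0 -> j * w = u * f12 ^+ 2 ->
  j * (f4 ^+ 2 - s * q * j2 ^+ 2) = j6 * j2 * (w * f12) ^+ 2 ->
  p ^+ 2 - s * q * r ^+ 2 = w ^+ 3 / u * (f6 * f4 * f12 / f2).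
Proof.
move=> /mulE-/(_ nf2) pE /mulE-/(_ nf6) rE.
rewrite -mulrA => /mulE-/(_ (mulf_neq0 nf4 nf6)) j2E /mulE-/(_ nf12) j6E nu nw.
move=> /mulE-/(_ nw) jE.
have nj : j != 0 by rewrite jE !mulf_neq0 ?invr_eq0 ?expf_neq0.
rewrite mulrC => /mulE-/(_ nj) eq.
(* The factor f4 / f2 turns f4 into p and j2 into r. *)
transitivity ((f4 ^+ 2 - s * q * j2 ^+ 2) * (f4 / f2) ^+ 2).
  by rewrite pE rE j2E; field; rewrite ?nf2 ?nf4 ?nf6.
by rewrite eq jE j6E j2E; field; rewrite ?nf2 ?nf4 ?nf6 ?nf12 ?nw ?nu.
Qed.

(** Here [a], [b], [A], [B] stand for phi(q), phi(-q), phi(q^3), phi(-q^3). The eta quotients for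
    [U] and [V] give a A V^2 = A^4 p r and b B U^2 = B^4 p r; with the modular and quartic equations
    these yield U W = p r b B. *)
Lemma eta_cubic (p r a b A B u w u' w' : F) : (2 : F) != 0 -> q != 0 ->
  p * f2 = f4 ^+ 2 -> r * f6 = f12 ^+ 2 ->
  b * f2 = f1 ^+ 2 -> B * f6 = f3 ^+ 2 ->
  a * f1 ^+ 2 * f4 ^+ 2 = f2 ^+ 5 -> A * f3 ^+ 2 * f12 ^+ 2 = f6 ^+ 5 ->
  a * A - b * B = 4 * q * p * r ->
  A ^+ 4 - B ^+ 4 = 16 * q ^+ 3 * r ^+ 4 ->
  u * f2 = f1 -> w * f6 = f3 ->
  u' * f1 * f4 = f2 ^+ 2 -> w' * f3 * f12 = f6 ^+ 2 ->
  p ^+ 2 + q * r ^+ 2 = w ^+ 3 / u * (f6 * f4 * f12 / f2) ->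
  p ^+ 2 - q * r ^+ 2 = w' ^+ 3 / u' * (f6 * f4 * f12 / f2) ->
  p ^+ 2 - 3 * q * r ^+ 2 = f1 ^+ 3 * f4 * f12 / (f3 * f2 ^+ 2).
Proof.
move=> n2 nq /mulE-/(_ nf2) pE /mulE-/(_ nf6) rE /mulE-/(_ nf2) bE /mulE-/(_ nf6) BE.
rewrite -mulrA => /mulE aE; rewrite -mulrA => /mulE AE.
have {}aE := aE (mulf_neq0 (expf_neq0 2 nf1) (expf_neq0 2 nf4)).
have {}AE := AE (mulf_neq0 (expf_neq0 2 nf3) (expf_neq0 2 nf12)).
set U := p ^+ 2 + _; set V := p ^+ 2 - _; set W := p ^+ 2 - _ => cub quart.
move=> /mulE-/(_ nf2) uE /mulE-/(_ nf6) wE.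
rewrite -mulrA => /mulE-/(_ (mulf_neq0 nf1 nf4)) u'E.
rewrite -mulrA => /mulE-/(_ (mulf_neq0 nf3 nf12)) w'E.
rewrite uE wE u'E w'E => UE VE.
have np : p != 0 by rewrite pE mulf_neq0 ?invr_eq0 ?expf_neq0.
have nr : r != 0 by rewrite rE mulf_neq0 ?invr_eq0 ?expf_neq0.
have aV : a * A * V ^+ 2 = A ^+ 4 * p * r.
  by rewrite VE aE AE pE rE; field; rewrite ?nf1 ?nf2 ?nf3 ?nf4 ?nf6 ?nf12.
have bU : b * B * U ^+ 2 = B ^+ 4 * p * r.
  by rewrite UE bE BE pE rE; field; rewrite ?nf1 ?nf2 ?nf3 ?nf4 ?nf6 ?nf12.
have UW : U * W = p * r * b * B.
  have nk : 4 * q * p * r != 0.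
    by rewrite !mulf_neq0 // (_ : 4 = 2 * 2) ?mulf_neq0 //; ring.
  apply: (mulfI nk); apply/eqP; rewrite -subr_eq0; apply/eqP.
  (* Subtracting the two relations leaves p r b B = V^2 - 4 q^2 r^4, which factors as W U. *)
  transitivity ((a * A * V ^+ 2 - A ^+ 4 * p * r) - (b * B * U ^+ 2 - B ^+ 4 * p * r)
    + (A ^+ 4 - B ^+ 4 - 16 * q ^+ 3 * r ^+ 4) * p * r
    - (a * A - b * B - 4 * q * p * r) * V ^+ 2); first by rewrite /U /V /W; ring.
  by rewrite aV bU cub quart !subrr !mul0r !subr0 addr0.
have nU : U != 0.
  by rewrite UE !(mulf_neq0, expf_neq0, invr_eq0) // ?(mulf_neq0, expf_neq0, invr_eq0).
rewrite mulrC in UW; rewrite (mulE UW nU) UE pE rE bE BE.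
by field; rewrite ?nf1 ?nf2 ?nf3 ?nf4 ?nf6 ?nf12.
Qed.

Lemma eta_dissection1 (p r u w : F) :
  p * f2 = f4 ^+ 2 -> r * f6 = f12 ^+ 2 ->
  u * f1 * f4 = f2 ^+ 2 -> w * f3 * f12 = f6 ^+ 2 ->
  p ^+ 2 - q * r ^+ 2 = w ^+ 3 / u * (f6 * f4 * f12 / f2) ->
  f1 * f4 ^+ 4 * f6 ^+ 6 = (p ^+ 2 - q * r ^+ 2) * p * r * (f2 ^+ 4 * f3 ^+ 3).
Proof.
move=> /mulE-/(_ nf2) pE /mulE-/(_ nf6) rE.
rewrite -mulrA => /mulE-/(_ (mulf_neq0 nf1 nf4)) uE.
rewrite -mulrA => /mulE-/(_ (mulf_neq0 nf3 nf12)) wE ->.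
by rewrite uE wE pE rE; field; rewrite ?nf1 ?nf2 ?nf3 ?nf4 ?nf6 ?nf12.
Qed.

Lemma eta_dissection2 (p r : F) :
  p * f2 = f4 ^+ 2 ->
  p ^+ 2 - 3 * q * r ^+ 2 = f1 ^+ 3 * f4 * f12 / (f3 * f2 ^+ 2) ->
  f1 ^+ 3 * f4 ^+ 3 * f12 = (p ^+ 2 - 3 * q * r ^+ 2) * p * (f2 ^+ 3 * f3).
Proof.
by move=> /mulE-/(_ nf2) pE ->; rewrite pE; field; rewrite ?nf2 ?nf3.
Qed.

End EtaAlgebra.

(** * Eta identities through the fraction field of power series *)

Lemma eulerf_neq0 j : eulerf j != 0.
Proof. by apply: contraTneq (eulerf_unit j) => ->; rewrite unitr0. Qed.

Lemma qpoch_neq0 (b : bool) a d : (0 < a)%N -> (0 < d)%N -> qpoch b a d != 0.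
Proof.
by move=> a0 d0; apply/eqP => /(congr1 (fun f : fps => f 0%N)); rewrite coef_Fps big_ord0.
Qed.

Lemma tofrac_neq0 (f : fps) : f != 0 -> tofrac f != 0.
Proof. by rewrite tofrac_eq0. Qed.

(* psi(q^2) and psi(q^6), since n(n+1)/2 for n >= 0 and 2 i^2 + i for i in Z
   take the same values, each once. *)
Definition psi2 := theta false 4 2.
Definition psi6 := theta false 12 6.

Lemma psi2E : psi2 * eulerf 2 = eulerf 4 ^+ 2. Proof. exact: (theta_psi 2). Qed.
Lemma psi6E : psi6 * eulerf 6 = eulerf 12 ^+ 2. Proof. exact: (theta_psi 6). Qed.

Notation "f ^F" := (tofrac f) (at level 2, format "f ^F").

(** The case [b = false] gives p^2 - q r^2 and [b = true] its companion p^2 + q r^2; [psi_cubic]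
    combines both. *)
Lemma psi_weierstrass (b : bool) :
  psi2 ^F ^+ 2 - (-1) ^+ b * fpsX ^F * psi6 ^F ^+ 2 =
  (qpoch b 3 6) ^F ^+ 3 / (qpoch b 1 2) ^F *
    ((eulerf 6) ^F * (eulerf 4) ^F * (eulerf 12) ^F / (eulerf 2) ^F).
Proof.
have n j : (eulerf j)^F != 0 by rewrite tofrac_neq0 ?eulerf_neq0.
pose j := theta b 6 5 * theta b 6 1.

apply: (@eta_weierstrass _ _ _ _ _ _ _ _ _ _ _ _ _ (theta true 6 4) ^F
  (theta true 6 0) ^F _ _ j ^F) => //; rewrite ?tofrac_neq0 ?qpoch_neq0 //.
- by rewrite -!tofracM -tofracXn psi2E.
- by rewrite -!tofracM -tofracXn psi6E.
- by rewrite -!tofracM -!tofracXn -!tofracM theta_6_4.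
- by rewrite -!tofracM -!tofracXn (theta_phiN 6).
- by rewrite -!tofracM -!tofracXn -!tofracM theta_6_5_1.
have := congr1 (@tofrac _) (theta_weierstrass b).
rewrite theta_6_2 theta_6_3 !(tofracM, tofracXn, tofracB, tofracN, tofrac1).
done.
Qed.


(** At q^3, this follows from phi(q)^2 = phi(q^2)^2 + 4 q psi(q^4)^2, its image under q -> -q, and
    phi(q^2) psi(q^4) = psi(q^2)^2. *)
Lemma phi_quartic :
  theta false 3 0 ^+ 4 - theta true 3 0 ^+ 4 = 16 * fpsX ^+ 3 * psi6 ^+ 4.
Proof.
pose D := theta false 6 0; pose G := theta false 24 12.
have sq (b : bool) : theta b 3 0 ^+ 2 = D ^+ 2 + (-1) ^+ b * fpsX ^+ 3 * (2 * G) ^+ 2.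
  have e : theta b 3 0 * theta b 3 0 = D * D +
      (-1) ^+ b * (fpsX ^+ 3 * (theta false 6 6 * theta false 6 6)).
    exact: theta_schroeter.
  rewrite expr2 e (theta_double 6) // -/G; ring.
have DG : D * G = psi6 ^+ 2.
  have nz : eulerf 6 ^+ 2 * eulerf 24 ^+ 2 * eulerf 12 != 0.
    by rewrite !mulf_neq0 ?expf_neq0 ?eulerf_neq0.
  apply: (mulfI nz).
  have phiD : D * eulerf 6 ^+ 2 * eulerf 24 ^+ 2 = eulerf 12 ^+ 5 := theta_phi 6 isT.
  have psiG : G * eulerf 12 = eulerf 24 ^+ 2 := theta_psi 12 isT.
  transitivity ((D * eulerf 6 ^+ 2 * eulerf 24 ^+ 2) * (G * eulerf 12)).
    by clear sq phiD psiG; move: D G (eulerf 6) (eulerf 12) (eulerf 24) => *; ring.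
  rewrite phiD psiG.
  transitivity ((psi6 * eulerf 6) ^+ 2 * (eulerf 24 ^+ 2 * eulerf 12)).
    by rewrite psi6E; move: (eulerf 12) (eulerf 24) => *; ring.
  by move: psi6 (eulerf 6) (eulerf 12) (eulerf 24) => *; ring.
have sq4 (b : bool) : theta b 3 0 ^+ 4 = (theta b 3 0 ^+ 2) ^+ 2 by rewrite -exprM.
rewrite !sq4 !sq -[4%N in RHS]/(2 * 2)%N exprM -DG expr0 expr1.
by clear sq sq4 DG; move: D G fpsX => *; ring.
Qed.

Lemma psi_cubic :
  psi2 ^F ^+ 2 - 3 * fpsX ^F * psi6 ^F ^+ 2 =
  (eulerf 1) ^F ^+ 3 * (eulerf 4) ^F * (eulerf 12) ^F /
    ((eulerf 3) ^F * (eulerf 2) ^F ^+ 2).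
Proof.
have n j : (eulerf j)^F != 0 by rewrite tofrac_neq0 ?eulerf_neq0.
apply: (@eta_cubic _ fpsX^F _ _ _ _ (eulerf 6)^F _ (n 1) (n 2) (n 3) (n 4) (n 6) (n 12)
  psi2^F psi6^F (theta false 1 0)^F (theta true 1 0)^F (theta false 3 0)^F
  (theta true 3 0)^F (qpoch true 1 2)^F (qpoch true 3 6)^F
  (qpoch false 1 2)^F (qpoch false 3 6)^F).
- have -> : 2 = (2 : fps)^F by rewrite tofracMn tofrac1.
  rewrite tofrac_neq0 //; apply/eqP => /(congr1 (fun f : fps => f 0%N)).
  by rewrite coef_fpsD.
- exact: tofrac_neq0 fpsX_neq0.
- by rewrite -!tofracM -tofracXn psi2E.
- by rewrite -!tofracM -tofracXn psi6E.
- by rewrite -!tofracM -!tofracXn (theta_phiN 1).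
- by rewrite -!tofracM -!tofracXn (theta_phiN 3).
- by rewrite -!tofracXn -!tofracM (theta_phi 1) // tofracXn.
- by rewrite -!tofracXn -!tofracM (theta_phi 3) // tofracXn.
- have := congr1 (@tofrac _) theta_cubic_modular.
  rewrite (theta_double 1) // (theta_double 3) //.
  rewrite !(tofracM, tofracXn, tofracB, tofracN, tofracD, tofrac1) => ->.
  by rewrite /psi2 /psi6; ring.
- have := congr1 (@tofrac _) phi_quartic.
  rewrite !(tofracM, tofracXn, tofracB, tofracN, tofracD, tofrac1) => ->.
  by congr (_ * _ * _); ring.
- by rewrite -tofracM -eulerf_odd_even.
- by rewrite -tofracM -(eulerf_odd_even 3).
- by rewrite -!tofracM -tofracXn (qpochN_odd 1).
- by rewrite -!tofracM -tofracXn (qpochN_odd 3).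
- by have := psi_weierstrass true; rewrite expr1 mulN1r mulNr opprK.
by have := psi_weierstrass false; rewrite expr0 mul1r.
Qed.

Lemma eulerf_dissection1 :
  eulerf 1 * eulerf 4 ^+ 4 * eulerf 6 ^+ 6 =
  (psi2 ^+ 2 - fpsX * psi6 ^+ 2) * psi2 * psi6 * (eulerf 2 ^+ 4 * eulerf 3 ^+ 3).
Proof.
have n j : (eulerf j)^F != 0 by rewrite tofrac_neq0 ?eulerf_neq0.
apply/eqP; rewrite -tofrac_eq !(tofracM, tofracB, tofracXn); apply/eqP.
apply: (@eta_dissection1 _ _ _ _ _ _ _ _ (n 1) (n 2) (n 3) (n 4) (n 6) (n 12)
  _ _ (qpoch false 1 2)^F (qpoch false 3 6)^F).
- by rewrite -!tofracM -tofracXn psi2E.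
- by rewrite -!tofracM -tofracXn psi6E.
- by rewrite -!tofracM -tofracXn (qpochN_odd 1).
- by rewrite -!tofracM -tofracXn (qpochN_odd 3).
by have := psi_weierstrass false; rewrite expr0 mul1r.
Qed.

Lemma eulerf_dissection2 :
  eulerf 1 ^+ 3 * eulerf 4 ^+ 3 * eulerf 12 =
  (psi2 ^+ 2 - 3 * fpsX * psi6 ^+ 2) * psi2 * (eulerf 2 ^+ 3 * eulerf 3).
Proof.
have n j : (eulerf j)^F != 0 by rewrite tofrac_neq0 ?eulerf_neq0.
have e3 : (3 : fps)^F = 3 by rewrite tofracMn tofrac1.
apply/eqP; rewrite -tofrac_eq !(tofracM, tofracB, tofracXn) e3; apply/eqP.
apply: (@eta_dissection2 _ _ _ _ _ _ _ (n 2) (n 3)).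
  by rewrite -!tofracM -tofracXn psi2E.
exact: psi_cubic.
Qed.

(** * Signs of coefficients *)

Definition nonneg (f : fps) := forall n, 0 <= f n.

Lemma nonneg1 : nonneg 1. Proof. by move=> n; rewrite coef_fps1; case: eqP. Qed.

Lemma nonnegM f g : nonneg f -> nonneg g -> nonneg (f * g).
Proof.
by move=> f0 g0 n; rewrite coef_fpsM sumr_ge0 // => i _; rewrite mulr_ge0.
Qed.

Lemma coef_mul_ge f g m n : nonneg f -> nonneg g -> f m * g n <= (f * g) (m + n)%N.
Proof.
move=> f0 g0; rewrite coef_fpsM (bigD1 (inord m)) //= inordK; last by lia.
by rewrite addKn lerDl sumr_ge0 // => i _; rewrite mulr_ge0.
Qed.

Lemma coef_mul_gt0 f g m n : nonneg f -> nonneg g -> 0 < f m -> 0 < g n ->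
  0 < (f * g) (m + n)%N.
Proof.
move=> f0 g0 fm gn; apply: lt_le_trans (coef_mul_ge _ _ _ _ f0 g0).
by rewrite mulr_gt0.
Qed.

Lemma coef_mul_eq0 (f g : fps) n :
  (forall i j, (i + j = n)%N -> f i = 0 \/ g j = 0) -> (f * g) n = 0.
Proof.
move=> z; rewrite coef_fpsM big1 // => i _; have lti := ltn_ord i.
by case: (z i (n - i)%N) => [|->|->]; rewrite ?mul0r ?mulr0 //; lia.
Qed.

Definition supp_dvd (d : nat) (f : fps) := forall n, ~~ (d %| n)%N -> f n = 0.

Lemma supp_dvdM d f g : supp_dvd d f -> supp_dvd d g -> supp_dvd d (f * g).
Proof.
move=> sf sg n ndn; apply: coef_mul_eq0 => i j ij.
have [di|/sf] := boolP (d %| i)%N; last by left.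
by right; apply: sg; apply: contra ndn; rewrite -ij; apply: dvdn_add.
Qed.

Lemma supp_dvd1 d : supp_dvd d 1.
Proof. by move=> n nd; rewrite coef_fps1; case: eqP nd => // ->; rewrite dvdn0. Qed.

Definition pos_dvd (d : nat) (f : fps) :=
  [/\ nonneg f, supp_dvd d f & forall n, (d %| n)%N -> 0 < f n].

Lemma pos_dvdM d f g : nonneg f -> supp_dvd d f -> 0 < f 0%N ->
  pos_dvd d g -> pos_dvd d (f * g).
Proof.
move=> f0 sf f00 [g0 sg gpos]; split=> [||n dn]; [exact: nonnegM|exact: supp_dvdM|].
by rewrite -[n]add0n coef_mul_gt0 ?gpos.
Qed.

Lemma pos_dvdX d f m : pos_dvd d f -> pos_dvd d (f ^+ m.+1).
Proof.
move=> pf; elim: m => [|m IHm]; first by rewrite expr1.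
by rewrite exprS; case: pf => f0 sf fpos; apply: pos_dvdM; rewrite ?fpos.
Qed.

Lemma pos_dvd_iprod d F : (0 < d)%N ->
  (forall k, nonneg (F k)) -> (forall k, supp_dvd d (F k)) ->
  (forall k, F k 0%N = 1) -> (forall k, 0 < F k (d * k.+1)%N) ->
  pos_dvd d (iprod F).
Proof.
move=> d0 F0 sF F1 Fpos.
have P0 (n : nat) (P : pred 'I_n) : nonneg (\prod_(k < n | P k) F k).
  by apply: big_ind => [||k _]; [exact: nonneg1|exact: nonnegM|exact: F0].
have P1 (n : nat) (P : pred 'I_n) : (\prod_(k < n | P k) F k) 0%N = 1.
  elim/big_ind: _ => // f g f1 g1; by rewrite coef_fpsM big_ord1 /= f1 g1.
split=> [n|n nd|n /dvdnP[[|m] ->]].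
- by rewrite coef_Fps; apply: P0.
- rewrite coef_Fps; suff: supp_dvd d (\prod_(k < n) F k) by apply.
  by apply: big_ind => [||k _]; [exact: supp_dvd1|exact: supp_dvdM|exact: sF].
- by rewrite coef_Fps big_ord0.
(* The exponent d (m + 1) is reached by taking it from factor [m] and the constant term 1 from all
   others. *)
have ltm : (m < m.+1 * d)%N by nia.
rewrite coef_Fps (bigD1 (Ordinal ltm)) //=; set g := \prod_(i < _ | _) _.
by rewrite mulnC -[(d * _)%N]addn0 coef_mul_gt0 ?P1 //; apply: P0.
Qed.

Definition geom (e : nat) : fps := Fps (fun n => (e %| n)%:R).

Lemma geomE e : (0 < e)%N -> (1 - fpsX ^+ e) * geom e = 1.
Proof.
move=> e0; apply: fpsP => n.
rewrite mulrBl mul1r coef_fpsB coef_fpsXnM coef_fps1 !coef_Fps.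
case: ltnP => [ltne|len].
  by rewrite subr0; case: n ltne => [|n] lt; rewrite ?dvdn0 // gtnNdvd.
by rewrite dvdn_subl // subrr; case: n len => //; lia.
Qed.

(** The inverse is the product of the geometric series in q^(d (k + 1)). *)
Lemma pos_dvd_eulerfV d : (0 < d)%N -> pos_dvd d (eulerf d)^-1.
Proof.
move=> d0; pose G k := geom (d * k.+1).
have -> : (eulerf d)^-1 = iprod G.
  apply: (mulrI (eulerf_unit d)); rewrite divrr ?eulerf_unit // eulerfE.
  rewrite -iprodM; first 1 last.
  - exact: iprodable_qpoch.
  - move=> k i ltik; rewrite coef_Fps coef_fps1; case: i ltik => [|i] lt.
      by rewrite dvdn0.
    by rewrite gtnNdvd //; nia.
  rewrite -[LHS]iprod1; apply: eq_iprod => k.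
  by rewrite expr1 mulN1r -mulnS; apply/esym/geomE; rewrite muln_gt0 d0.
apply: pos_dvd_iprod => // k.
- by move=> n; rewrite coef_Fps; case: dvdn.
- move=> n nd; rewrite coef_Fps (_ : (_ %| n)%N = false) //.
  by apply: contraNF nd; apply: dvdn_trans; rewrite dvdn_mulr.
- by rewrite coef_Fps dvdn0.
by rewrite coef_Fps dvdnn.
Qed.

Lemma pos_dvd_qpoch d : (0 < d)%N -> pos_dvd d (qpoch false d d).
Proof.
move=> d0; apply: pos_dvd_iprod => // k; rewrite ?expr0 ?mul1r.
- by move=> n; rewrite coef_fpsD coef_fps1 coef_fpsXn addr_ge0 //; case: eqP.
- move=> n nd; rewrite coef_fpsD coef_fps1 coef_fpsXn.
  have -> : (n == 0%N) = false by apply: contraNF nd => /eqP->.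
  have -> : (n == d + d * k)%N = false.
    by apply: contraNF nd => /eqP->; rewrite -mulnS dvdn_mulr.
  by [].
- by rewrite coef_fpsD coef_fps1 coef_fpsXn; case: eqP => //; lia.
rewrite coef_fpsD coef_fps1 coef_fpsXn -mulnS eqxx.
by case: eqP.
Qed.

Lemma theta_ge0 h c : nonneg (theta false h c).
Proof. by move=> n; rewrite coef_Fps sumr_ge0. Qed.

Lemma theta_eq0 h c n : (forall i, quad h c i <> n%:Z) -> theta false h c n = 0.
Proof. by move=> no; rewrite coef_Fps big1 // => i /eqP /no. Qed.

Lemma theta_gt0 h c n i : (0 < h)%N -> (c <= h)%N -> quad h c i = n%:Z ->
  0 < theta false h c n.
Proof.
move=> h0 lech ei; rewrite coef_Fps big_mkcond (bigD1_seq i) /=.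
- by rewrite ei eqxx ltr_wpDr // sumr_ge0 // => k _; case: ifP.
- by apply: mem_int_window; have := quad_ge h c i h0 lech; lia.
exact: int_window_uniq.
Qed.

(** Modulo 6 the exponent 4 i^2 + 2 i depends only on i modulo 3, and its values at 0, 1, 2 are 0,
    6, 20. *)
Lemma psi2_mod6 n : ~~ (n %% 6 \in [:: 0; 2])%N -> psi2 n = 0.
Proof.
rewrite !inE => nn; apply: theta_eq0 => i; rewrite /quad => ei.
have [k [r [iE r3]]] : exists k r : int, i = 3 * k + r /\ (r = 0 \/ r = 1 \/ r = 2).
  by exists (i %/ 3)%Z, (i %% 3)%Z; lia.
have nE : n%:Z = 6 * (6 * k ^+ 2 + 4 * k * r + k) + (4 * r ^+ 2 + 2 * r).
  by rewrite -ei iE; ring.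
by move: nE r3; set m := 6 * k ^+ 2 + _ + _ => nE [|[]] rE; rewrite rE in nE; lia.
Qed.

Lemma psi2_gt0 n : (n \in [:: 0; 2; 6])%N -> 0 < psi2 n.
Proof.
by rewrite !inE => /or3P[] /eqP->;
  [apply: (@theta_gt0 _ _ _ 0)|apply: (@theta_gt0 _ _ _ (-1))|
   apply: (@theta_gt0 _ _ _ 1)].
Qed.

Lemma psi6_supp : supp_dvd 6 psi6.
Proof.
move=> n nn; apply: theta_eq0 => i; rewrite /quad => ei.
have nE : n%:Z = 6 * (2 * i ^+ 2 + i) by rewrite -ei; ring.
by move: nE; set m := 2 * i ^+ 2 + _ => nE; lia.
Qed.

Lemma psi6_gt0 : 0 < psi6 0%N.
Proof. exact: (@theta_gt0 _ _ _ 0). Qed.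

Lemma pos_dvd6_psi6 f : pos_dvd 6 f -> pos_dvd 6 (psi6 * f).
Proof. by apply: pos_dvdM; [exact: theta_ge0|exact: psi6_supp|exact: psi6_gt0]. Qed.

(* Every even residue modulo 12 is a sum of three exponents of psi2. *)
Lemma psi2_cube_gt0 d H k : (d %| 12)%N -> pos_dvd d H ->
  0 < (psi2 ^+ 3 * H) (2 * k)%N.
Proof.
move=> d12 [H0 _ Hpos].
have p0 : nonneg psi2 := theta_ge0 _ _.
have p30 : nonneg (psi2 ^+ 3).
  by rewrite !exprS expr0; do ![apply: nonnegM|exact: nonneg1] => //.
have p3 x y z : (x \in [:: 0; 2; 6])%N -> (y \in [:: 0; 2; 6])%N ->
    (z \in [:: 0; 2; 6])%N -> 0 < (psi2 ^+ 3) (x + (y + z))%N.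
  move=> hx hy hz; rewrite exprS expr2.
  apply: coef_mul_gt0; rewrite ?psi2_gt0 //; first exact: nonnegM.
  by apply: coef_mul_gt0; rewrite ?psi2_gt0.
have -> : (2 * k = 2 * (k %% 6) + 12 * (k %/ 6))%N by lia.
apply: coef_mul_gt0 => //; last by apply: Hpos; rewrite dvdn_mulr.
have: (k %% 6 < 6)%N by rewrite ltn_mod.
case: (k %% 6)%N => [|[|[|[|[|[|//]]]]]] _.
- exact: (p3 0 0 0)%N.
- exact: (p3 2 0 0)%N.
- exact: (p3 2 2 0)%N.
- exact: (p3 6 0 0)%N.
- exact: (p3 6 2 0)%N.
exact: (p3 6 2 2)%N.
Qed.

Lemma psi2_supp : supp_dvd 2 psi2.
Proof. by move=> n nn; apply: psi2_mod6; rewrite !inE; lia. Qed.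

(** The term with [H] is even and positive at every even exponent. The other term is odd; its
    exponents are 1 plus a multiple of 6 plus an exponent of [psi2], hence 1 or 3 modulo 6. *)
Lemma sign_pattern d H K (c n : nat) (S : fps) : (0 < c)%N ->
  (2 %| d)%N -> (d %| 12)%N -> pos_dvd d H -> pos_dvd 6 K ->
  S = psi2 ^+ 3 * H - c%:R * (fpsX * (psi2 * K)) ->
  [/\ 0 < S (2 * n)%N, S (6 * n + 1)%N < 0, S (6 * n + 3)%N < 0 &
      S (6 * n + 5)%N = 0].
Proof.
move=> c0 d2 d12 pH pK SE.
have sH : supp_dvd 2 (psi2 ^+ 3 * H).
  have s2 := psi2_supp; rewrite exprS expr2.
  apply: (supp_dvdM _ _ _ (supp_dvdM _ _ _ s2 (supp_dvdM _ _ _ s2 s2))).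
  case: pH => _ sH _ m m2; apply: sH; apply: contra m2; exact: dvdn_trans.
have Scoef m : S m = (psi2 ^+ 3 * H) m - c%:R * (fpsX * (psi2 * K)) m.
  by rewrite SE coef_fpsB !mulr_natl; congr (_ - _); elim: (c) => [|k IHk];
    rewrite ?mulr0n // !mulrS coef_fpsD IHk.
have Sodd m : S (2 * m + 1)%N = - (c%:R * (psi2 * K) (2 * m)%N).
  rewrite Scoef sH ?sub0r; last by lia.
  by rewrite addn1 coef_fpsXM.
case: pK => K0 sK Kpos.
have p0 : nonneg psi2 := theta_ge0 _ _.
have c_gt0 : (0 : int) < c%:R by rewrite ltr0n.
split.
- have ev : (fpsX * (psi2 * K)) (2 * n)%N = 0.
    rewrite coef_fpsXM; case: n => // n; rewrite mulnS /=.
    apply: coef_mul_eq0 => i j ij; have [j6|/sK] := boolP (6 %| j)%N; last by right.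
    by left; apply: psi2_supp; lia.
  by rewrite Scoef ev mulr0 subr0; apply: psi2_cube_gt0 pH.
- rewrite (_ : 6 * n + 1 = 2 * (0 + 3 * n) + 1)%N; last by lia.
  rewrite Sodd oppr_lt0 mulr_gt0 // mulnDr; apply: coef_mul_gt0 => //.
    exact: psi2_gt0.
  by apply: Kpos; lia.
- rewrite (_ : 6 * n + 3 = 2 * (1 + 3 * n) + 1)%N; last by lia.
  rewrite Sodd oppr_lt0 mulr_gt0 // mulnDr; apply: coef_mul_gt0 => //.
    exact: psi2_gt0.
  by apply: Kpos; lia.
(* Residue 5 would require an exponent of [psi2] congruent to 4 modulo 6. *)
rewrite (_ : 6 * n + 5 = 2 * (2 + 3 * n) + 1)%N; last by lia.
rewrite Sodd coef_mul_eq0 ?mulr0 ?oppr0 // => i j ij.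
have [j6|/sK] := boolP (6 %| j)%N; last by right.
by left; apply: psi2_mod6; rewrite !inE; lia.
Qed.

(** * Dissections of the two eta quotients and their signs *)

Lemma eta_quotient1 :
  eulerf 1 / eulerf 2 ^+ 4 / eulerf 3 ^+ 3 * eulerf 4 ^+ 4 =
  psi2 ^+ 3 * (psi6 / eulerf 6 ^+ 6) -
  fpsX * (psi2 * (psi6 * (psi6 * (psi6 / eulerf 6 ^+ 6)))).
Proof.
have V j k : eulerf j ^+ k / eulerf j ^+ k = 1 by rewrite divrr ?unitrX ?eulerf_unit.
have := eulerf_dissection1; have := V 6 6; have := V 3 3; have := V 2 4.
move: (eulerf 1) (eulerf 2 ^+ 4) (eulerf 3 ^+ 3) (eulerf 4 ^+ 4) (eulerf 6 ^+ 6).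
move: psi2 psi6 fpsX => p r q x1 x2 x3 x4 x6.
move: (x2^-1) (x3^-1) (x6^-1) => y2 y3 y6 e2 e3 e6 E.
transitivity (x1 * x4 * x6 * (y2 * y3 * y6)).
  by rewrite -[LHS]mulr1 -e6; ring.
rewrite E; transitivity ((p ^+ 2 - q * r ^+ 2) * p * r * y6 * ((x2 * y2) * (x3 * y3))).
  by ring.
by rewrite e2 e3; ring.
Qed.

Lemma psi6_qpoch : psi6 = qpoch false 6 6 * eulerf 12.
Proof.
apply: (mulIf (eulerf_neq0 6)); rewrite psi6E mulrAC.
by rewrite [X in _ * X * _](eulerfE 6) qpoch_mulN // -eulerfE.
Qed.

(** One factor [psi6] absorbs the division by [eulerf 12] and becomes [qpoch false 6 6], which is
    positive at every multiple of 6, whereas the inverse of [eulerf 12] only reaches multiples of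
    12. *)
Lemma eta_quotient2 :
  eulerf 1 ^+ 3 / eulerf 2 ^+ 3 / eulerf 3 * eulerf 4 ^+ 3 =
  psi2 ^+ 3 / eulerf 12 - 3 * (fpsX * (psi2 * (psi6 * qpoch false 6 6))).
Proof.
have V j k : eulerf j ^+ k / eulerf j ^+ k = 1 by rewrite divrr ?unitrX ?eulerf_unit.
have := eulerf_dissection2; have := psi6_qpoch.
have := V 12 1; have := V 3 1; have := V 2 3; rewrite !expr1.
move: (eulerf 1 ^+ 3) (eulerf 2 ^+ 3) (eulerf 3) (eulerf 4 ^+ 3) (eulerf 12).
move: psi2 psi6 fpsX (qpoch false 6 6) => p r q R x1 x2 x3 x4 x12.
move: (x2^-1) (x3^-1) (x12^-1) => y2 y3 y12 e2 e3 e12 rE E.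
transitivity (x1 * x4 * x12 * (y2 * y3 * y12)).
  by rewrite -[LHS]mulr1 -e12; ring.
rewrite E.
transitivity ((p ^+ 3 * y12 - 3 * (q * (p * (r * (r * y12))))) * ((x2 * y2) * (x3 * y3))).
  by ring.
by rewrite e2 e3 {2}rE -[R * _ * _]mulrA e12; ring.
Qed.

Theorem theorem6p1 (t1 t2 t3 t4 : int)
    (ht : (t1, t2, t3, t4) \in [:: (1, -4, -3, 4); (3, -3, -1, 3)])
    (n : nat) :
  [/\ 0 < eta_coef [:: t1; t2; t3; t4] (2 * n)%N,
      eta_coef [:: t1; t2; t3; t4] (6 * n + 1)%N < 0,
      eta_coef [:: t1; t2; t3; t4] (6 * n + 3)%N < 0
    & eta_coef [:: t1; t2; t3; t4] (6 * n + 5)%N = 0].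
Proof.
have U := eulerf_unit.
rewrite /eta_coef /=; move: ht; rewrite !inE => /orP[] /eqP[-> -> -> ->] /=.
- have p6 : pos_dvd 6 (eulerf 6 ^- 6).
    by rewrite -exprVn; apply/pos_dvdX/pos_dvd_eulerfV.
  apply: (@sign_pattern 6 (psi6 * eulerf 6 ^- 6)
            (psi6 * (psi6 * (psi6 * eulerf 6 ^- 6))) 1) => //.
  + exact: pos_dvd6_psi6.
  + by do 3!apply: pos_dvd6_psi6.
  rewrite !big_ord_recr big_ord0 /= mul1r.
  by rewrite mul1r; exact: eta_quotient1.
have q6 := pos_dvd_qpoch 6 isT.
apply: (@sign_pattern 12 (eulerf 12)^-1 (psi6 * qpoch false 6 6) 3) => //.
- exact: pos_dvd_eulerfV.
- exact: pos_dvd6_psi6.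
rewrite !big_ord_recr big_ord0 /= mul1r.
exact: eta_quotient2.
Qed.
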